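(* Let $X=\mathbb{R}/\mathbb{Z}$ with its standard metric, $\mu_1=\mu_2$ Lebesgue measure, $(X,T_1,\mu_1)$ exponentially mixing for $BV$ against $L^\infty$, and $T_2(x)=x+\alpha\bmod 1$. Suppose that for some $\varepsilon>0$ and some constant $c(\alpha)>0$, \[ |q\alpha-p|\ge c(\alpha)\,\frac{(\log q)^2(\log\log q)^{1+\varepsilon}}{q^2} \] for all $p\in\mathbb{Z}$ and all sufficiently large $q\in\mathbb{N}$. Let $(r_n)_n$ be a decreasing sequence of positive numbers such that for some $0<\delta<\varepsilon$ and some $c_0>0$, $r_n\ge c_0\frac{(\log n)^2(\log\log n)^{1+\delta}}{n^2}$ for all large $n$. Then $(\mu_1\times\mu_2)(\liminf_n E_{n,r_n}^{T_1,T_2})=1$.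
   Context: $(X,T,\mu)$ is exponentially mixing for $BV$ against $L^\infty$ if there are $C,\theta>0$ such that for all $\psi$ of bounded variation, all $\varphi\in L^\infty(\mu)$ and all $n\ge0$, $\bigl|\int\psi\cdot\varphi\circ T^n\,d\mu-\int\psi\,d\mu\int\varphi\,d\mu\bigr|\le C\|\psi\|_{BV}\|\varphi\|_{L^\infty}e^{-\theta n}$. For $n\in\mathbb{N}$ and $r>0$, $E_{n,r}^{T_1,T_2}:=\{(x,y)\in X\times X : d(T_1^i x, T_2^j y)<r \text{ for some } 0\le i,j<n\}$; $E_{n,r_n}^{T_1,T_2}$ denotes this set with $r=r_n$. *)

(* Defs.v *)
(* The circle X = R/Z is modelled by representatives
   in [0,1) (a subset of the reals R : realType), with the quotient metric. *)
From HB Require Import structures.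
From mathcomp Require Import all_boot all_order all_algebra.
From mathcomp Require Import all_classical all_reals all_analysis.
From mathcomp Require Import ess_sup_inf.
Set Implicit Arguments. Unset Strict Implicit. Unset Printing Implicit Defensive.
Import Order.TTheory GRing.Theory Num.Theory.
Import numFieldNormedType.Exports.
Local Open Scope classical_set_scope.
Local Open Scope ring_scope.

Section Circle.
Variable R : realType.

Definition frac (x : R) : R := x - (Num.floor x)%:~R.

Definition circ_dist (x y : R) : R :=
  let t := frac (x - y) in Num.min t (1 - t).

Definition I01 : set R := `[0%R, 1%R[%classic.

Lemma measurable_I01 : measurable I01.
Proof. exact: measurable_itv. Qed.

Definition mu01 := mrestr (@lebesgue_measure R) measurable_I01.

(* functions on R/Z are represented by their values on [0,1);
   psi \o frac is the associated 1-periodic function, and its variation on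
   [0,1] is the variation of psi around the circle *)
Definition circ_variation (psi : R -> R) : \bar R :=
  total_variation 0 1 (psi \o frac).

Definition is_BV (psi : R -> R) : Prop :=
  bounded_variation 0 1 (psi \o frac).

Definition BV_norm (psi : R -> R) : \bar R :=
  (ereal_sup [set (`|psi x|)%:E | x in I01] + circ_variation psi)%E.

Definition Linf_norm (phi : R -> R) : \bar R :=
  ess_sup mu01 (fun x => (`|phi x|)%:E).

Definition is_Linf (phi : R -> R) : Prop :=
  measurable_fun I01 phi /\ (Linf_norm phi < +oo)%E.

Definition circle_mpt (T : R -> R) : Prop :=
  (forall x, I01 x -> I01 (T x)) /\ measurable_fun I01 T /\
  (forall A, measurable A -> A `<=` I01 ->
     @lebesgue_measure R (I01 `&` T @^-1` A) = @lebesgue_measure R A).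

Definition exp_mixing_BV_Linf (T : R -> R) : Prop :=
  exists C theta : R, 0 < C /\ 0 < theta /\
  forall (psi phi : R -> R) (n : nat), is_BV psi -> is_Linf phi ->
    (`| \int[@lebesgue_measure R]_(x in I01) (psi x * phi (iter n T x))%:E
        - (\int[@lebesgue_measure R]_(x in I01) (psi x)%:E)
          * (\int[@lebesgue_measure R]_(x in I01) (phi x)%:E) |
     <= C%:E * BV_norm psi * Linf_norm phi * (expR (- theta * n%:R))%:E)%E.

Definition rotation (alpha : R) (x : R) : R := frac (x + alpha).

Definition E_set (T1 T2 : R -> R) (n : nat) (r : R) : set (R * R) :=
  [set xy | exists i j : nat, (i < n)%N /\ (j < n)%N /\
              circ_dist (iter i T1 xy.1) (iter j T2 xy.2) < r].

Definition set_liminf (A : nat -> set (R * R)) : set (R * R) :=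
  \bigcup_(N in [set: nat]) \bigcap_(n in [set n | (N <= n)%N]) A n.

End Circle.

(* Main.v *)
(** Along n = 2^k let rho_k = a k^2 / 4^k with a small. The Diophantine condition
    makes the rho_k-neighbourhoods of the points y + j alpha, j < n, pairwise
    disjoint, so their union V has mass of order k^2 / 2^k while its indicator has
    variation O(n). Sampling the T1-orbit at multiples of s = K k and using mixing
    once per sample, with the indicator of V^c as BV observable and "no later
    sample meets V" as bounded observable, the probability of avoiding V at all
    n / s sample times is at most (1 - |V|)^(n/s) + O(n^2 e^(-theta s)), which is
    exponentially small in k. Integrating over y, the Borel-Cantelli lemma along
    n = 2^k and the monotonicity of r give the theorem. *)

Require Import Defs.
From HB Require Import structures.
From mathcomp Require Import all_boot all_order all_algebra.
From mathcomp Require Import all_classical all_reals all_analysis.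
From mathcomp Require Import ess_sup_inf measurable_realfun.
From mathcomp Require Import zify ring lra.
(* Restores [Defs.frac], shadowed by the fraction field of MathComp. *)
Import Defs.
Import Order.TTheory GRing.Theory Num.Theory.
Import numFieldNormedType.Exports.
Local Open Scope classical_set_scope.
Local Open Scope ring_scope.

(** * Orbits of the rotation and their separation *)

Section Rotation.
Context {R : realType}.
Implicit Types (x y z alpha : R).

Lemma frac_ge0 x : 0 <= frac x.
Proof. by rewrite subr_ge0 floor_le. Qed.

Lemma frac_lt1 x : frac x < 1.
Proof. by rewrite ltrBlDl addrC; have := lt_succ_floor x; rewrite intrD addrC. Qed.

Lemma frac_id x : I01 x -> frac x = x.
Proof.
rewrite /I01 /= in_itv /= => /andP[x0 x1].
by rewrite /frac (@floor_def _ _ 0) ?subr0 // x0 add0r x1.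
Qed.

Lemma frac1 : frac (1 : R) = 0.
Proof. by rewrite /frac floor1 subrr. Qed.

Lemma frac_fracD x y : frac (frac x + y) = frac (x + y).
Proof.
rewrite {2}/frac addrAC [_ - _]addrC -(mulrNz 1).
by rewrite /frac floorDzr ?intr_int// intrKfloor intrD mulrNz; ring.
Qed.

Lemma iter_rotation alpha y j : I01 y ->
  iter j (rotation alpha) y = frac (y + j%:R * alpha).
Proof.
move=> y01; elim: j => [|j IH]; first by rewrite mul0r addr0 frac_id.
by rewrite iterS IH /rotation frac_fracD -addrA -natr1 mulrDl mul1r.
Qed.

(** Real intervals can therefore stand in for arcs. When z < 0 the floor is at most -1, so 1 - frac
    z <= -z. *)
Lemma circ_dist_le x y : circ_dist x y <= `|x - y|.
Proof.
rewrite /circ_dist; set z := x - y; rewrite ge_min /frac.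
have [z0|z0] := leP 0 z.
  by rewrite ger0_norm // lerBlDr lerDl ler0z floor_ge0 z0.
have: (Num.floor z <= -1)%R by rewrite -ltzD1 addNr floor_lt0.
rewrite -(ler_int R) => h; apply/orP; right; rewrite ltr0_norm //; lra.
Qed.

(** The base point y cancels: up to an integer the difference is (j - i) alpha, with 0 < j - i < n
    once the indices are ordered. *)
Lemma rotation_separated alpha y d (n i j : nat) :
  (forall q p, (0 < q < n)%N -> d <= `|q%:R * alpha - p%:~R|) ->
  (i < n)%N -> (j < n)%N -> i != j ->
  d <= `|frac (y + i%:R * alpha) - frac (y + j%:R * alpha)|.
Proof.
move=> sep; wlog ij : i j / (i < j)%N => [H|] iN jN nij.
  by case: (ltngtP i j) nij => // ij _; [|rewrite distrC]; apply: H => //; lia.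
rewrite distrC /frac.
set a := Num.floor _; set b := Num.floor _.
have -> : y + j%:R * alpha - a%:~R - (y + i%:R * alpha - b%:~R) =
   (j - i)%N%:R * alpha - (a - b)%:~R by rewrite natrB ?(ltnW ij)// intrB; lra.
by apply: sep; lia.
Qed.

End Rotation.

(** * Variation bounds by a monotone majorant *)

Section Variation.
Context {R : realType}.

(** The hypothesis forces W to be nondecreasing on [a, b], and the variation of a monotone function
    along a partition telescopes. *)
Lemma total_variation_le_increment (a b : R) (f W : R -> R) :
  a <= b ->
  (forall x y, a <= x -> x <= y -> y <= b -> `|f y - f x| <= W y - W x) ->
  (total_variation a b f <= (W b - W a)%:E)%E.
Proof.
move=> ab fW; apply: ge_ereal_sup => _ [_ [s abs <-]] <-.
have Wnd : {in `[a, b] &, {homo W : x y / x <= y}}.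
  move=> x y; rewrite !in_itv /= => /andP[ax _] /andP[_ yb] xy.
  by rewrite -subr_ge0 (le_trans _ (fW _ _ ax xy yb)).
rewrite lee_fin -(nondecreasing_variation Wnd abs) /variation.
rewrite big_nat [leRHS]big_nat; apply: ler_sum => i /andP[_ ilt].
rewrite (le_trans _ (ler_norm _)) // fW //.
- by apply: itv_partition_nth_ge abs; rewrite ltnS ltnW.
- case: (abs) => + _ => /(pathP b) /(_ _ ilt) /= H; exact: ltW.
- exact: itv_partition_nth_le abs.
Qed.

End Variation.

(** * The complement of finitely many disjoint intervals as a BV observable *)

Section Avoidance.
Context {R : realType}.
Variables (n : nat) (lo : nat -> R) (rho : R).

(* Under [disj] this is the indicator of the complement of the intervals; written
   as a sum, its integral and variation are immediate. *)
Definition gap_fun (x : R) : R :=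
  1 - \sum_(j < n) ((lo j < x) && (x < lo j + rho))%:R.

Hypothesis rho0 : 0 <= rho.
Hypothesis lo0 : forall j, (j < n)%N -> 0 <= lo j.
Hypothesis lo1 : forall j, (j < n)%N -> lo j + rho <= 1.
Hypothesis disj : forall i j x, (i < n)%N -> (j < n)%N ->
  lo i < x < lo i + rho -> lo j < x < lo j + rho -> i = j.

(** By [disj] at most one summand is nonzero at any given point. *)
Lemma gap_fun_ge0 x : 0 <= gap_fun x.
Proof.
rewrite subr_ge0.
have [[i Hi]|H] := pselect (exists i : 'I_n, lo i < x < lo i + rho).
  rewrite (bigD1 i) //= Hi big1 ?addr0 // => j ji.
  case: (boolP (_ && _)) => // Hj; case/eqP: ji; apply: val_inj => /=.
  exact: disj Hj Hi.
by rewrite big1 // => i _; case: (boolP (_ && _)) => // Hi; case: H; exists i.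
Qed.

Lemma gap_fun_le1 x : gap_fun x <= 1.
Proof. by rewrite lerBlDr lerDl sumr_ge0. Qed.

Lemma gap_fun_eq1 x :
  (forall j, (j < n)%N -> ~~ (lo j < x < lo j + rho)) -> gap_fun x = 1.
Proof.
by move=> H; rewrite /gap_fun big1 ?subr0 // => j _; rewrite (negbTE (H _ _)).
Qed.

(** Only x = 1 needs an argument: open intervals inside [0, 1] contain neither endpoint, so the
    values at 0 and 1 are both 1. Closing up the circle thus adds no jump. *)
Lemma gap_fun_frac x : 0 <= x <= 1 -> gap_fun (frac x) = gap_fun x.
Proof.
case/andP=> x0; rewrite le_eqVlt => /orP[/eqP->|x1]; last first.
  by rewrite frac_id // /I01 /= in_itv /= x0 x1.
rewrite frac1 !gap_fun_eq1 // => j jn.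
  by rewrite [1 < _]ltNge lo1 // andbF.
by rewrite ltNge lo0.
Qed.

Lemma gap_fun_variation : (circ_variation gap_fun <= (n%:R *+ 2)%:E)%E.
Proof.
(* [W] counts the endpoints passed by x, at most 2n of them. The strict test on the left and the
   weak test on the right match the jumps of the indicator of an open interval. *)
pose W (x : R) : R := \sum_(j < n) ((lo j < x)%R%:R + (lo j + rho <= x)%R%:R).
apply: (@le_trans _ _ (W 1 - W 0)%:E).
  apply: total_variation_le_increment => // x y x0 xy y1 /=.
  rewrite !gap_fun_frac ?x0 ?y1 ?(le_trans x0) ?(le_trans xy) //.
  rewrite /gap_fun /W opprB addrC addrA subrK -!sumrB.
  apply: le_trans (ler_norm_sum _ _ _) _; apply: ler_sum => j _.
  have := rho0; case: (ltP (lo j) x); case: (ltP (lo j) y);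
    case: (leP (lo j + rho) x); case: (leP (lo j + rho) y) => * /=;
    rewrite ?mulr1n ?mulr0n ler_norml; apply/andP; split; lra.
rewrite lee_fin lerBlDr; apply: (@le_trans _ _ (n%:R *+ 2)); last first.
  by rewrite lerDl sumr_ge0 // => j _; rewrite addr_ge0.
have -> : n%:R *+ 2 = \sum_(j < n) 2 :> R.
  by rewrite sumr_const card_ord -!mulrnA mulnC.
have bool2 (b c : bool) : b%:R + c%:R <= 2 :> R.
  by rewrite -natrD ler_nat; case: b c => [] [].
by apply: ler_sum => j _; exact: bool2.
Qed.

Lemma gap_fun_BV : is_BV gap_fun.
Proof.
apply/bounded_variationP => //.
by rewrite ge0_fin_numE ?total_variation_ge0 // (le_lt_trans gap_fun_variation) ?ltry.
Qed.

Lemma gap_fun_BV_norm : (BV_norm gap_fun <= (1 + n%:R *+ 2)%:E)%E.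
Proof.
rewrite EFinD; apply: leeD; last exact: gap_fun_variation.
apply: ge_ereal_sup => _ [x _ <-].
by rewrite lee_fin ger0_norm ?gap_fun_ge0 ?gap_fun_le1.
Qed.

Lemma measurable_gap_fun D : measurable_fun D gap_fun.
Proof.
apply: measurable_funTS; apply: measurable_funB => //.
apply: measurable_sum => j.
have -> : (fun x : R => ((lo j < x) && (x < lo j + rho))%:R : R) =
   \1_(`]lo j, lo j + rho[%classic).
  apply/funext => x; rewrite indicE; congr (nat_of_bool _)%:R.
  by apply/idP/idP => [H|/set_mem]; [apply/mem_set|]; rewrite /= in_itv.
exact: measurable_indic.
Qed.

Lemma lebesgue_I01 : lebesgue_measure (@I01 R) = 1%E.
Proof. by rewrite /I01 lebesgue_measure_itv /= lte_fin ltr01 oppr0 adde0. Qed.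

Lemma bounded01_integrable (f : R -> R) : measurable_fun (@I01 R) f ->
  (forall x, I01 x -> 0 <= f x <= 1) ->
  lebesgue_measure.-integrable (@I01 R) (EFin \o f).
Proof.
move=> mf f01; apply: measurable_bounded_integrable => //.
- exact: measurable_I01.
- by rewrite [X in (X < _)%E]lebesgue_I01 ltry.
- exists 1; split; first exact: num_real.
  move=> M M1 x /f01 /andP[f0 f1] /=; rewrite ger0_norm //.
  exact: le_trans f1 (ltW M1).
Qed.

Lemma integral_gap_fun :
  (\int[lebesgue_measure]_(x in @I01 R) (gap_fun x)%:E = (1 - n%:R * rho)%:E)%E.
Proof.
have mI := @measurable_I01 R.
pose F (j : 'I_n) (x : R) : R := \1_(`]lo j, lo j + rho[%classic : set R) x.
have mF j : measurable_fun (@I01 R) (F j) by exact: measurable_indic.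
have iF j : lebesgue_measure.-integrable (@I01 R) (EFin \o F j).
  apply: bounded01_integrable => // x _.
  by rewrite /F indicE ler0n lern1 leq_b1.
under eq_integral => x _.
  rewrite /gap_fun EFinB -sumEFin.
  under eq_bigr => j _.
    rewrite (_ : _%:E = (EFin \o F j) x); last first.
      rewrite /= /F indicE; congr ((nat_of_bool _)%:R)%:E.
      by apply/idP/idP => [H|/set_mem]; [apply/mem_set|]; rewrite /= in_itv.
    over.
  over.
rewrite /= integralB //=; last 2 first.
- by apply: bounded01_integrable => // x _; rewrite ler01 lexx.
- have H := @integrable_sum _ _ _ (@lebesgue_measure R) _ mI _ (index_enum _)
    xpredT (fun j => EFin \o F j) (fun j _ => iF j).
  exact: H.
rewrite integral_cst //= mul1e [X in (X - _)%E]lebesgue_I01 integral_sum //.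
rewrite (eq_bigr (fun _ => rho%:E)); last first.
  move=> j _; rewrite /= integral_indic //= setIidl.
    rewrite lebesgue_measure_itv /= lte_fin ltrDl.
    by case: ltgtP rho0 => // [r0 _|<- _]; rewrite // -EFinB addrAC subrr add0r.
  move=> x; rewrite /I01 /= !in_itv /= => /andP[a b].
  by rewrite (le_trans (lo0 _ (ltn_ord j)) (ltW a)) (lt_le_trans b (lo1 _ (ltn_ord j))).
by rewrite sumEFin sumr_const card_ord -EFinB mulr_natl.
Qed.

(** * Sampling the orbit of a mixing map *)

Variable T : R -> R.
Hypothesis mptT : circle_mpt T.

Lemma iter_I01 s x : I01 x -> I01 (iter s T x).
Proof. by case: mptT => TI _ x01; elim: s => //= s IH; exact: TI. Qed.

Lemma measurable_iter s : measurable_fun (@I01 R) (iter s T).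
Proof.
case: (mptT) => TI [mT _]; elim: s => [|s IH] /=; first exact: measurable_id.
apply: (measurable_comp (@measurable_I01 R) _ mT IH).
by move=> _ [x x01 <-]; exact: iter_I01.
Qed.

Variable s : nat.

(** The product of [gap_fun] over the samples x, T^s x, ..., T^((m-1)s) x: under [disj], the
    indicator of missing every interval at all m times. Peeling off the first sample leaves a
    function of T^s x, which is the shape of a correlation at lag s. *)
Fixpoint avoid (m : nat) (x : R) : R :=
  if m is m'.+1 then gap_fun x * avoid m' (iter s T x) else 1.

Lemma avoid01 m x : 0 <= avoid m x <= 1.
Proof.
elim: m x => [|m IH] x /=; first by rewrite ler01 lexx.
have /andP[a0 a1] := IH (iter s T x).
by rewrite mulr_ge0 ?gap_fun_ge0 //= mulr_ile1 ?gap_fun_ge0 ?gap_fun_le1.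
Qed.

Lemma avoid_eq1 m x :
  (forall i j, (i < m)%N -> (j < n)%N ->
     ~~ (lo j < iter (i * s) T x < lo j + rho)) -> avoid m x = 1.
Proof.
elim: m x => //= m IH x H.
rewrite gap_fun_eq1 ?mul1r ?IH //.
  by move=> i j im jn; rewrite -iterD; have := H i.+1 j im jn; rewrite mulSn addnC.
by move=> j jn; have := H 0%N j isT jn.
Qed.

Lemma measurable_avoid m : measurable_fun (@I01 R) (avoid m).
Proof.
elim: m => [|m IH] /=; first exact: measurable_cst.
apply: measurable_funM; first exact: measurable_gap_fun.
apply: (measurable_comp (@measurable_I01 R) _ IH (measurable_iter s)).
by move=> _ [x x01 <-]; exact: iter_I01.
Qed.

Variables C theta : R.
Hypothesis C0 : 0 < C.
Hypothesis mixing : forall (psi phi : R -> R) (n : nat), is_BV psi -> is_Linf phi ->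
    (`| \int[@lebesgue_measure R]_(x in @I01 R) (psi x * phi (iter n T x))%:E
        - (\int[@lebesgue_measure R]_(x in @I01 R) (psi x)%:E)
          * (\int[@lebesgue_measure R]_(x in @I01 R) (phi x)%:E) |
     <= C%:E * BV_norm psi * Linf_norm phi * (expR (- theta * n%:R))%:E)%E.

Lemma avoid_Linf_norm m : (Linf_norm (avoid m) <= 1)%E.
Proof.
apply: ess_sup_ler => x; have /andP[a0 a1] := avoid01 m x.
by rewrite lee_fin ger0_norm.
Qed.

(** Mixing at lag s, with [gap_fun] as BV observable and [avoid m] as bounded one, gives P (m+1) <=
    w P m + eta. Since 0 <= w <= 1, iterating gives w^m and lets the errors at most add up. *)
Lemma integral_avoid_le m :
  (\int[lebesgue_measure]_(x in @I01 R) (avoid m x)%:E <=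
   ((1 - n%:R * rho) ^+ m +
    m%:R * (C * (1 + n%:R *+ 2) * expR (- theta * s%:R)))%:E)%E.
Proof.
set w := 1 - n%:R * rho; set eta := C * _ * _.
have mI := @measurable_I01 R.
have eta0 : 0 <= eta by rewrite !mulr_ge0 ?expR_ge0 ?addr_ge0 ?mulrn_wge0 // ltW.
have w0 : 0 <= w.
  rewrite -lee_fin -integral_gap_fun; apply: integral_ge0 => x _.
  by rewrite lee_fin gap_fun_ge0.
have w1 : w <= 1 by rewrite lerBlDr lerDl mulr_ge0.
have iA k : lebesgue_measure.-integrable (@I01 R) (EFin \o avoid k).
  by apply: bounded01_integrable => [|x _]; [exact: measurable_avoid|exact: avoid01].
pose P k := fine (\int[lebesgue_measure]_(x in @I01 R) (avoid k x)%:E)%E.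
have PE k : (\int[lebesgue_measure]_(x in @I01 R) (avoid k x)%:E = (P k)%:E)%E.
  by rewrite /P fineK // integrable_fin_num //; exact: iA.
rewrite PE lee_fin; elim: m => [|m IH].
  have := PE 0%N; rewrite /= integral_cst //= mul1e [X in X = _]lebesgue_I01.
  by case=> <-; rewrite mul0r addr0 expr0.
have Linf : is_Linf (avoid m).
  by split; [exact: measurable_avoid|rewrite (le_lt_trans (avoid_Linf_norm m)) ?ltry].
have BV0 : (0 <= BV_norm gap_fun)%E.
  rewrite adde_ge0 ?total_variation_ge0 //.
  apply: (@le_trans _ _ `|gap_fun 0|%:E); first by rewrite lee_fin.
  by apply: ereal_sup_ubound; exists 0 => //; rewrite /I01 /= in_itv /= lexx ltr01.
have := mixing _ _ s gap_fun_BV Linf; rewrite integral_gap_fun -/w PE.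
(* By the recursion, the correlation integral is the integral of [avoid m.+1]. *)
rewrite -/(avoid m.+1) (PE m.+1) => H.
have {}H : (`|(P m.+1)%:E - w%:E * (P m)%:E| <= eta%:E)%E.
  apply: le_trans H _; rewrite /eta !EFinM.
  rewrite lee_wpmul2r ?lee_fin ?expR_ge0 //.
  have CB0 : (0 <= C%:E * BV_norm gap_fun)%E by rewrite mule_ge0 // lee_fin ltW.
  apply: le_trans (lee_wpmul2l CB0 (avoid_Linf_norm m)) _.
  by rewrite mule1 lee_wpmul2l ?gap_fun_BV_norm // lee_fin ltW.
move: H; rewrite -EFinM -EFinB /= lee_fin => H.
have {}H := le_trans (ler_norm _) H; move: H.
rewrite lerBlDl => H; apply: (le_trans H).
have : w * P m <= w * (w ^+ m + m%:R * eta) by rewrite ler_wpM2l.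
have : w * (m%:R * eta) <= m%:R * eta by apply: ler_piMl => //; exact: mulr_ge0.
rewrite exprS -natr1; lra.
Qed.

(** [avoid m] is 1 on A and nonnegative elsewhere, so it dominates the indicator of A. *)
Lemma avoiding_set_measure m (A : set R) : measurable A -> A `<=` @I01 R ->
  (forall x i j, A x -> (i < m)%N -> (j < n)%N ->
     ~~ (lo j < iter (i * s) T x < lo j + rho)) ->
  (lebesgue_measure A <= ((1 - n%:R * rho) ^+ m +
    m%:R * (C * (1 + n%:R *+ 2) * expR (- theta * s%:R)))%:E)%E.
Proof.
move=> mA AI HA; apply: le_trans (integral_avoid_le m).
rewrite -[X in lebesgue_measure X](setIidl AI) -integral_indic //; last first.
  exact: measurable_I01.
apply: ge0_le_integral => //.
- exact: measurable_I01.
- by apply/measurable_EFinP; exact: measurable_indic.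
- by apply/measurable_EFinP; exact: measurable_avoid.
- move=> x _; rewrite lee_fin indicE; case: (boolP (x \in A)) => [/set_mem xA|_].
    by rewrite avoid_eq1 // => i j; exact: HA.
  by have /andP[] := avoid01 m x.
Qed.

End Avoidance.

(** * Dyadic estimates and the Diophantine condition *)

Section Arithmetic.
Context {R : realType}.
Implicit Types alpha c e : R.

(** This is (log_2 n)^2 / n^2 at n = 2^k, the common scale of the Diophantine bound and of the
    radii. *)
Definition dyadic_weight (k : nat) : R := k%:R ^+ 2 / 4 ^+ k.

Lemma dyadic_weight_gt0 k : (0 < k)%N -> 0 < dyadic_weight k.
Proof. by move=> k0; rewrite divr_gt0 ?exprn_gt0 ?ltr0n. Qed.

(** The claim amounts to k + 1 <= 2k; it fails at k = 0, where the weight vanishes. *)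
Lemma dyadic_weightS k : (0 < k)%N -> dyadic_weight k.+1 <= dyadic_weight k.
Proof.
move=> k0; rewrite /dyadic_weight [4 ^+ k.+1]exprS invfM mulrA.
rewrite ler_pM2r ?invr_gt0 ?exprn_gt0 // ler_pdivrMr //.
have : 1 <= k%:R :> R by rewrite ler1n.
rewrite -natr1; set t := k%:R; nra.
Qed.

Lemma dyadic_weight_le l k : (0 < l)%N -> (l <= k)%N ->
  dyadic_weight k <= dyadic_weight l.
Proof.
move=> l0 /subnKC <-; elim: (k - l)%N => [|i IH]; first by rewrite addn0.
by rewrite addnS (le_trans _ IH) // dyadic_weightS // addn_gt0 l0.
Qed.

Lemma dyadic_weight_le1 k : (0 < k)%N -> dyadic_weight k <= 1.
Proof.
move=> k0; apply: le_trans (dyadic_weight_le 1 k isT k0) _.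
by rewrite /dyadic_weight expr1n; lra.
Qed.

(** The factor 2 is there because 3^2 > 2^3; the bound a <= 1/2 will absorb it. *)
Lemma sqr_le_double_expn2 (k : nat) : (k ^ 2 <= 2 * 2 ^ k)%N.
Proof.
case: k => [|[|[|]]] // k; elim: k => // k; rewrite [(2 ^ k.+4)%N]expnS; nia.
Qed.

(** From e^e on the iterated logarithm is at least 1, so one threshold serves all exponents. *)
Lemma powR_lnln_ge1 : exists q0, forall (q : nat) e, (q0 <= q)%N -> 0 <= e ->
  1 <= ln (ln (q%:R : R)) `^ e.
Proof.
exists (Num.bound (expR (expR (1 : R)))) => q e q0 e0.
have ee : expR (expR 1) < q%:R :> R.
  by apply: lt_le_trans (archi_boundP (expR_ge0 _)) _; rewrite ler_nat.
have lq : expR 1 <= ln (q%:R : R).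
  by rewrite -[leLHS]expRK ler_ln ?posrE ?expR_gt0 ?(lt_trans _ ee) ?expR_gt0 // ltW.
have llq : 1 <= ln (ln (q%:R : R)).
  by rewrite -[leLHS]expRK ler_ln ?posrE ?expR_gt0 // (lt_le_trans _ lq) ?expR_gt0.
by rewrite -[leLHS](powRr0 (ln (ln (q%:R : R)))) ler_powR.
Qed.

(** On a dyadic block ln q >= l ln 2 and q^2 <= 4 * 4^l; the second bound is the source of the
    divisor 4. *)
Lemma lnln_weight_ge (c e : R) : 0 <= c -> 0 <= e ->
  exists l0, forall l q : nat, (l0 <= l)%N -> (2 ^ l <= q < 2 ^ l.+1)%N ->
  c * ln 2 ^+ 2 / 4 * dyadic_weight l <=
  c * ln (q%:R : R) ^+ 2 * ln (ln (q%:R : R)) `^ e / q%:R ^+ 2.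
Proof.
move=> c0 e0; have [q0 Hq0] := powR_lnln_ge1.
exists q0 => l q ll /andP[lq ql].
have q1 : 1 <= ln (ln (q%:R : R)) `^ e.
  apply: Hq0 => //; rewrite (leq_trans _ lq) // (leq_trans ll) //.
  exact/ltnW/ltn_expl.
have qpos : (0 < q)%N by rewrite (leq_trans _ lq) // expn_gt0.
have lnq : l%:R * ln 2 <= ln (q%:R : R).
  rewrite mulr_natl -lnXn // ler_ln ?posrE ?exprn_gt0 ?ltr0n //.
  by rewrite -natrX ler_nat.
have ln20 : 0 <= ln 2 :> R by rewrite ln_ge0 // ler1n.
have -> : c * ln 2 ^+ 2 / 4 * dyadic_weight l =
    c * (l%:R * ln 2) ^+ 2 / (2 ^+ l.+1) ^+ 2.
  rewrite /dyadic_weight -exprM mulnC exprM (_ : 2 ^+ 2 = 4 :> R); last by ring.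
  by rewrite [4 ^+ l.+1]exprS exprMn; field; rewrite expf_neq0 // pnatr_eq0.
apply: ler_pM.
- by rewrite mulr_ge0 ?sqr_ge0.
- by rewrite invr_ge0 sqr_ge0.
- rewrite -[leLHS]mulr1 ler_pM // ?mulr_ge0 ?sqr_ge0 //.
  by rewrite ler_wpM2l // lerXn2r // ?nnegrE ?mulr_ge0 // (le_trans _ lnq) ?mulr_ge0.
- rewrite lef_pV2 ?posrE ?exprn_gt0 ?ltr0n // lerXn2r // ?nnegrE ?exprn_ge0 //.
  by rewrite -natrX ler_nat ltnW.
Qed.

Lemma dist_int_ge (z : R) (p : int) : Num.min (frac z) (1 - frac z) <= `|z - p%:~R|.
Proof.
rewrite ge_min /frac; have [pf|fp] := leP p (Num.floor z).
  by apply/orP; left; rewrite (le_trans _ (ler_norm _)) // lerD2l lerN2 ler_int.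
move: fp; rewrite -lezD1 -(ler_int R) intrD => fp.
apply/orP; right; rewrite distrC (le_trans _ (ler_norm _)) //; lra.
Qed.

(** Each q alpha has positive distance to the integers, and only finitely many q are involved. *)
Lemma irrational_gap alpha (B : nat) :
  (forall (q : nat) (p : int), (0 < q)%N -> q%:R * alpha != p%:~R) ->
  exists2 m : R, 0 < m & forall (q : nat) (p : int), (0 < q < B)%N ->
    m <= `|q%:R * alpha - p%:~R|.
Proof.
move=> irr; elim: B => [|B [m m0 Hm]]; first by exists 1 => // q p; rewrite ltn0 andbF.
case: B Hm => [|B] Hm; first by exists 1 => // q p; lia.
set z := B.+1%:R * alpha.
exists (Num.min m (Num.min (frac z) (1 - frac z))).
  rewrite !lt_min m0 [0 < 1 - _]subr_gt0 frac_lt1 andbT /=.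
  by rewrite lt_neqAle frac_ge0 andbT eq_sym subr_eq0 irr.
move=> q p /andP[q0]; rewrite ltnS leq_eqVlt => /orP[/eqP->|qB].
  by rewrite ge_min dist_int_ge orbT.
by rewrite ge_min Hm // q0.
Qed.

(** Large q are handled in their own dyadic block, whose weight is at least that of k. The finitely
    many small q share a positive gap, and the weight is at most 1. *)
Lemma diophantine_separation alpha c e : 0 < c -> 0 < e ->
  (exists Q : nat, forall (q : nat) (p : int), (Q <= q)%N ->
     c * ln (q%:R : R) ^+ 2 * ln (ln (q%:R : R)) `^ e / q%:R ^+ 2
       <= `|q%:R * alpha - p%:~R|) ->
  exists2 a : R, 0 < a & forall (k q : nat) (p : int), (0 < k)%N ->
     (0 < q < 2 ^ k)%N -> a * dyadic_weight k <= `|q%:R * alpha - p%:~R|.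
Proof.
move=> c0 e0 [Q HQ].
have [l0 Hl0] := lnln_weight_ge c e (ltW c0) (ltW e0).
pose b : R := c * ln 2 ^+ 2 / 4.
have b0 : 0 < b.
  by rewrite divr_gt0 // mulr_gt0 // exprn_gt0 // ln_gt0 // ltr1n.
pose L := (maxn l0 Q).+1.
have big q p : (2 ^ L <= q)%N ->
    b * dyadic_weight (trunc_log 2 q) <= `|q%:R * alpha - p%:~R| /\
    (L <= trunc_log 2 q)%N.
  move=> Lq; have q0 : (0 < q)%N by rewrite (leq_trans _ Lq) // expn_gt0.
  have Ltr : (L <= trunc_log 2 q)%N by exact: trunc_log_max.
  split=> //; apply: le_trans (Hl0 _ q _ _) (HQ q p _).
  - by rewrite (leq_trans _ Ltr) // /L; lia.
  - exact: trunc_log_bounds.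
  - rewrite (leq_trans _ Lq) // (leq_trans _ (ltnW (ltn_expl _ _))) // /L; lia.
(* If q alpha were the integer p, the multiple q 2^L would be in the large range and yet at distance
   0 from p 2^L. *)
have irr (q : nat) (p : int) : (0 < q)%N -> q%:R * alpha != p%:~R.
  move=> q0; apply/eqP => E.
  have [|+ Ltr] := big (q * 2 ^ L)%N (p * (2 ^ L)%N%:Z).
    by rewrite leq_pmull.
  rewrite natrM intrM [_ * alpha]mulrAC E subrr normr0 leNgt mulr_gt0 //.
  by rewrite dyadic_weight_gt0 // (leq_trans _ Ltr).
have [m m0 Hm] := irrational_gap alpha (2 ^ L) irr.
exists (Num.min m b); first by rewrite lt_min m0 b0.
move=> k q p k0 /andP[q0 qk].
have v0 := ltW (dyadic_weight_gt0 k k0).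
have [qL|Lq] := ltnP q (2 ^ L).
  apply: (le_trans _ (Hm q p _)); last by rewrite q0.
  apply: (@le_trans _ _ (m * 1)); last by rewrite mulr1.
  by apply: ler_pM; rewrite ?ge_min ?lexx ?dyadic_weight_le1 // le_min !ltW.
have [H Ltr] := big q p Lq; apply: le_trans H.
apply: ler_pM => //; first by rewrite le_min !ltW.
  by rewrite ge_min lexx orbT.
rewrite dyadic_weight_le // ?(leq_trans _ Ltr) //.
rewrite -(leq_exp2l _ _ (isT : 1 < 2)%N) (leq_trans _ (ltnW qk)) //.
exact: trunc_logP.
Qed.

(** Here w = a k^2 / n and m is about n / (K k), so (1 - w)^m is of order e^(-a k / K). The mixing
    error is at most 3 C n^2 / 8^k = 3 C / 2^k. *)
Lemma geometric_avoidance_bound (a C theta : R) (K : nat) :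
  0 < a <= 2^-1 -> 0 < C -> (0 < K)%N -> 8 <= expR (theta * K%:R) ->
  exists A x : R, [/\ 0 < A, 0 < x < 1 & forall k n m, (0 < k)%N ->
   n = (2 ^ k)%N -> m = (n %/ (K * k))%N ->
   (1 - n%:R * (a * dyadic_weight k)) ^+ m +
   m%:R * (C * (1 + n%:R *+ 2) * expR (- theta * (K * k)%:R)) <= A * x ^+ k].
Proof.
move=> /andP[a0 a2] C0 K0 H8.
have K0' : 0 < K%:R :> R by rewrite ltr0n.
pose u := expR (- (a / K%:R)); pose x := Num.max u 2^-1.
have u1 : u < 1 by rewrite expR_lt1 oppr_lt0 divr_gt0.
(* [expR 1] pays for rounding in the quotient m, and 3 comes from 1 + 2n <= 3n. *)
exists (expR 1 + 3 * C), x; split.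
- by rewrite addr_gt0 ?expR_gt0 // mulr_gt0.
- by rewrite lt_max expR_gt0 /= gt_max u1 /=; lra.
move=> k n m k0 nk mk.
have k0' : 0 < k%:R :> R by rewrite ltr0n.
have n0 : 0 < n%:R :> R by rewrite nk ltr0n expn_gt0.
have n1 : 1 <= n%:R :> R by rewrite nk ler1n expn_gt0.
have nE : 4 ^+ k = n%:R ^+ 2 :> R.
  by rewrite nk natrX -exprM mulnC exprM; congr (_ ^+ _); ring.
set w := n%:R * (a * dyadic_weight k).
have wE : w = a * k%:R ^+ 2 / n%:R.
  by rewrite /w /dyadic_weight nE; field; rewrite gt_eqF.
have w0 : 0 <= w by rewrite wE !mulr_ge0 ?invr_ge0 ?sqr_ge0 // ltW.
have w1 : w <= 1.
  rewrite wE ler_pdivrMr // mul1r.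
  have : k%:R ^+ 2 <= 2 * n%:R :> R.
    by rewrite nk -natrX -natrM ler_nat sqr_le_double_expn2.
  have : 0 <= k%:R ^+ 2 :> R by exact: sqr_ge0.
  nra.
have ux : u ^+ k <= x ^+ k by rewrite lerXn2r ?nnegrE ?expR_ge0 ?le_max ?expR_ge0 ?lexx.
have hx : 2^-1 ^+ k <= x ^+ k.
  by rewrite lerXn2r ?nnegrE ?invr_ge0 ?le_max ?invr_ge0 ?ler0n ?orbT ?lexx ?orbT.
rewrite mulrDl; apply: lerD.
  apply: (@le_trans _ _ (expR 1 * u ^+ k)); last by rewrite ler_wpM2l ?expR_ge0.
  apply: (@le_trans _ _ (expR (- w) ^+ m)).
    by rewrite lerXn2r ?nnegrE ?expR_ge0 ?subr_ge0 // expR_ge1Dx.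
  rewrite /u -!expRM_natl -expRD ler_expR.
  (* Rounding down only gives n < (m + 1) K k, so the exponent is bounded through w (m + 1); the
     surplus e^w is at most e. *)
  have : n%:R <= (m.+1 * (K * k))%N%:R :> R.
    by rewrite ler_nat mk ltnW // ltn_ceil // muln_gt0 K0.
  rewrite !natrM -natr1 => Hm.
  have -> : k%:R * - (a / K%:R) = - (a * k%:R / K%:R) by ring.
  have : a * k%:R / K%:R <= w * (m%:R + 1).
    rewrite ler_pdivrMr // wE.
    have -> : a * k%:R ^+ 2 / n%:R * (m%:R + 1) * K%:R =
        a * k%:R * ((m%:R + 1) * (K%:R * k%:R)) / n%:R by ring.
    by rewrite ler_pdivlMr // ler_wpM2l // mulr_ge0 // ltW.
  by set t := _ / K%:R; lra.
apply: (@le_trans _ _ (3 * C * 2^-1 ^+ k)); last first.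
  by rewrite ler_wpM2l // mulr_ge0 // ltW.
have E8 : expR (- theta * (K * k)%:R) <= (8 ^+ k)^-1.
  rewrite mulNr expRN lef_pV2 ?posrE ?expR_gt0 ?exprn_gt0 //.
  by rewrite natrM mulrA mulrC expRM_natl lerXn2r // ?nnegrE ?expR_ge0.
have mn : m%:R <= n%:R :> R by rewrite mk ler_nat leq_div.
have -> : 3 * C * 2^-1 ^+ k = n%:R * (C * (3 * n%:R) * (8 ^+ k)^-1).
  have -> : 8 ^+ k = n%:R ^+ 3 :> R.
    by rewrite nk natrX -exprM mulnC exprM; congr (_ ^+ _); ring.
  by rewrite exprVn -natrX -nk; field; rewrite gt_eqF.
apply: ler_pM => //.
  by rewrite !mulr_ge0 ?expR_ge0 ?addr_ge0 ?mulrn_wge0 // ltW.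
apply: ler_pM; rewrite ?expR_ge0 //.
  by rewrite !mulr_ge0 ?addr_ge0 ?mulrn_wge0 // ltW.
rewrite ler_pM2l //; lra.
Qed.

End Arithmetic.

(** * Measurability, sections and summability *)

Section Measure.
Context {R : realType}.
Local Notation mu := (@lebesgue_measure R).
Local Notation I2 := (@I01 R `*` @I01 R).

Lemma measurable_I2 : measurable I2.
Proof. by apply: measurableX; exact: measurable_I01. Qed.

Lemma product_lebesgue_I2 : (mu \x mu)%E I2 = 1%E.
Proof.
rewrite product_measure1E; [|exact: measurable_I01|exact: measurable_I01].
by rewrite [X in (X * _)%E]lebesgue_I01 [X in (_ * X)%E]lebesgue_I01 mule1.
Qed.

Lemma measurable_frac : measurable_fun setT (@frac R).
Proof.
apply: measurable_funB; first exact: measurable_id.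
apply: nondecreasing_measurable => // x y xy.
by rewrite ler_int le_floor.
Qed.

Lemma measurable_iter_rotation alpha j : measurable_fun setT (iter j (@rotation R alpha)).
Proof.
elim: j => [|j IH] /=; first exact: measurable_id.
apply: (measurableT_comp measurable_frac); exact: measurable_funD.
Qed.

Lemma measurable_E_set (T : R -> R) alpha n r : circle_mpt T ->
  measurable (E_set T (rotation alpha) n r `&` I2).
Proof.
move=> mptT; have mI2 := measurable_I2.
have -> : E_set T (rotation alpha) n r `&` I2 =
  \bigcup_(i in [set i | (i < n)%N]) \bigcup_(j in [set j | (j < n)%N])
   (I2 `&` [set xy | circ_dist (iter i T xy.1) (iter j (rotation alpha) xy.2) < r]).
  apply/seteqP; split => [xy [[i [j [iN [jN H]]]] xyI]|xy [i iN [j jN [xyI H]]]].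
    by exists i => //; exists j.
  by split=> //; exists i, j.
apply: bigcup_measurable => i _; apply: bigcup_measurable => j _.
have mf : measurable_fun I2
    (fun xy : R * R => iter i T xy.1 - iter j (rotation alpha) xy.2).
  apply: measurable_funB.
    apply: (measurable_comp (@measurable_I01 R) _ (measurable_iter T mptT i)).
      by move=> _ [[x y] [x01 _] <-].
    by apply: measurable_funTS; exact: measurable_fst.
  apply: measurable_funTS.
  exact: (measurableT_comp (measurable_iter_rotation alpha j) measurable_snd).
have mg := measurableT_comp measurable_frac mf.
have mc : measurable_fun I2
    (fun xy : R * R => circ_dist (iter i T xy.1) (iter j (rotation alpha) xy.2)).
  by apply: measurable_minr => //; apply: measurable_funB.
set f := (fun xy => _) in mc.
rewrite (_ : [set xy | _] = f @^-1` `]-oo, r[); first exact: mc.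
by apply/seteqP; split=> xy /=; rewrite in_itv.
Qed.

Lemma product_measure_le (A : set (R * R)) (b : R) : 0 <= b ->
  measurable A -> A `<=` I2 ->
  (forall y, I01 y -> (mu (ysection A y) <= b%:E)%E) ->
  ((mu \x mu)%E A <= b%:E)%E.
Proof.
move=> b0 mA AI H.
(* Uniqueness of the product measure permits integrating over y the measures of the x-slices. *)
rewrite (@product_measure_unique _ _ _ _ _ _ _ (mu \x^ mu)%E) //; last first.
  by move=> B C mB mC /=; rewrite product_measure2E.
have mI := @measurable_I01 R.
apply: (@le_trans _ _ (\int[mu]_y (b%:E * (\1_(@I01 R) y)%:E))%E); last first.
  rewrite ge0_integralZl ?lee_fin //; last first.
    by apply/measurable_EFinP; exact: measurable_indic.
  by rewrite integral_indic // setIT [X in (_ * X)%E]lebesgue_I01 mule1.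
apply: ge0_le_integral => //.
- exact: measurable_fun_ysection.
- apply: measurable_funeM; apply/measurable_EFinP; exact: measurable_indic.
- move=> y _; rewrite indicE; case: (boolP (y \in _)) => [/set_mem yI|yI].
    by rewrite mule1; exact: H.
  rewrite mule0 /= (_ : ysection A y = set0) ?measure0 // -subset0 => x.
  by rewrite /ysection /= => /set_mem /AI [_ /mem_set]; rewrite (negbTE yI).
Qed.

Lemma geometric_series_lty (u : nat -> \bar R) (A x : R) : 0 <= A -> 0 < x < 1 ->
  (forall k, (0 <= u k <= (A * x ^+ k)%:E)%E) -> (\sum_(k <oo) u k < +oo)%E.
Proof.
move=> A0 /andP[x0 x1] H.
apply: (@le_lt_trans _ _ (A / (1 - x))%:E); last exact: ltry.
apply: lime_le; first by apply: is_cvg_nneseries => k _ _; case/andP: (H k).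
apply: nearW => n; apply: (@le_trans _ _ (series (geometric A x) n)%:E).
  by rewrite /series /= -sumEFin; apply: lee_sum => k _; case/andP: (H k).
by rewrite lee_fin geometric_le_lim // ger0_norm ?ltW.
Qed.

End Measure.

(** * Missing the rotation orbit, and comparison of radii *)

Section Main.
Context {R : realType}.
Local Notation mu := (@lebesgue_measure R).
Local Notation I2 := (@I01 R `*` @I01 R).

(** For fixed y, each orbit point gets an interval of length rho within distance rho of it. Centres
    2 rho apart make these disjoint, and a sample falling in one of them is a close encounter. *)
Lemma missed_rotation_orbit_measure (T : R -> R) (alpha rho y C theta : R)
    (n s m : nat) (A : set R) :
  circle_mpt T -> 0 < C ->
  (forall (psi phi : R -> R) (n : nat), is_BV psi -> is_Linf phi ->
    (`| \int[mu]_(x in @I01 R) (psi x * phi (iter n T x))%:E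
        - (\int[mu]_(x in @I01 R) (psi x)%:E)
          * (\int[mu]_(x in @I01 R) (phi x)%:E) |
     <= C%:E * BV_norm psi * Linf_norm phi * (expR (- theta * n%:R))%:E)%E) ->
  0 < rho <= 2^-1 -> I01 y ->
  (forall q p, (0 < q < n)%N -> 2 * rho <= `|q%:R * alpha - p%:~R|) ->
  (0 < s)%N -> (m * s <= n)%N ->
  measurable A -> A `<=` @I01 R ->
  (forall x, A x -> ~ E_set T (rotation alpha) n rho (x, y)) ->
  (mu A <= ((1 - n%:R * rho) ^+ m +
    m%:R * (C * (1 + n%:R *+ 2) * expR (- theta * s%:R)))%:E)%E.
Proof.
move=> mptT C0 mixing /andP[rho0 rho2] y01 sep s0 msn mA AI HA.
pose a j : R := frac (y + j%:R * alpha).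
(* One half of the ball around [a j], chosen inside the open interval ]0, 1[ so
   that no interval wraps around the circle. *)
pose lo j := if a j < 2^-1 then a j else a j - rho.
have near j x : lo j < x < lo j + rho -> `|x - a j| < rho.
  by rewrite /lo ltr_norml; case: ifP => _ /andP[? ?]; apply/andP; split; lra.
apply: (avoiding_set_measure n lo rho (ltW rho0) _ _ _ T mptT s C theta C0 mixing) => //.
- move=> j _; rewrite /lo; case: ifPn => [_|]; first exact: frac_ge0.
  rewrite -leNgt; lra.
- move=> j _; have := frac_lt1 (y + j%:R * alpha); rewrite -/(a j) /lo.
  by case: ifPn => ?; lra.
- move=> i j x iN jN /near xi /near xj; apply/eqP/negP => /negP ij.
  have := rotation_separated alpha y _ _ _ _ sep iN jN ij.
  rewrite leNgt -/(a i) -/(a j) => /negP; apply.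
  have -> : a i - a j = (x - a j) - (x - a i) by lra.
  by rewrite (le_lt_trans (ler_normB _ _)) //; lra.
- move=> x i j xA im jn; apply/negP => /near H; apply: (HA x xA).
  (* Sample i is taken at time i s < m s <= n. *)
  exists (i * s)%N, j; split; [|split => //=].
    by rewrite (leq_trans _ msn) // ltn_pmul2r.
  by rewrite iter_rotation // (le_lt_trans (circ_dist_le _ _)).
Qed.

Lemma E_setS (T1 T2 : R -> R) (n n' : nat) (r r' : R) : (n <= n')%N -> r <= r' ->
  E_set T1 T2 n r `<=` E_set T1 T2 n' r'.
Proof.
move=> nn rr xy [i [j [iN [jN H]]]]; exists i, j.
by rewrite (leq_trans iN) // (leq_trans jN) // (lt_le_trans H).
Qed.

(** The radius is taken at the far end of the block, where a decreasing r is smallest. The constant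
    16 combines the 4 of [lnln_weight_ge] with 4^(k+1) = 4 * 4^k. *)
Lemma dyadic_radius_le (c e : R) (r : nat -> R) : 0 < c -> 0 < e ->
  (exists N : nat, forall n : nat, (N <= n)%N ->
     c * ln (n%:R : R) ^+ 2 * ln (ln (n%:R : R)) `^ e / n%:R ^+ 2 <= r n) ->
  exists2 b : R, 0 < b & exists k0, forall k, (k0 <= k)%N ->
    b * dyadic_weight k <= r (2 ^ k.+1)%N.
Proof.
move=> c0 e0 [N HN]; have [l0 Hl0] := lnln_weight_ge c e (ltW c0) (ltW e0).
exists (c * ln 2 ^+ 2 / 16).
  by rewrite divr_gt0 // mulr_gt0 // exprn_gt0 // ln_gt0 // ltr1n.
exists (maxn l0 N) => k; rewrite geq_max => /andP[lk Nk].
apply: le_trans (HN _ _); last first.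
  by rewrite (leq_trans Nk) // (leq_trans (leqnSn _)) // ltnW // ltn_expl.
have kl : (2 ^ k.+1 <= 2 ^ k.+1 < 2 ^ k.+2)%N by rewrite leqnn ltn_exp2l // ltnSn.
apply: le_trans (Hl0 _ _ (leqW lk) kl).
rewrite /dyadic_weight [4 ^+ k.+1]exprS -(natr1 k).
have f0 : (4 ^+ k : R) != 0 by rewrite expf_neq0 // pnatr_eq0.
have -> : c * ln 2 ^+ 2 / 16 * (k%:R ^+ 2 / 4 ^+ k) =
  c * ln 2 ^+ 2 / 16 / 4 ^+ k * k%:R ^+ 2 by ring.
have -> : c * ln 2 ^+ 2 / 4 * ((k%:R + 1) ^+ 2 / (4 * 4 ^+ k)) =
  c * ln 2 ^+ 2 / 16 / 4 ^+ k * (k%:R + 1) ^+ 2 by field.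
apply: ler_wpM2l; last by rewrite lerXn2r ?nnegrE ?addr_ge0 // lerDl.
by apply: divr_ge0; rewrite ?exprn_ge0 // divr_ge0 // mulr_ge0 ?sqr_ge0 // ltW.
Qed.

End Main.

(** * Borel-Cantelli along powers of two and interpolation between them *)

Theorem mainTheorem10 (R : realType) (T1 : R -> R) (alpha eps c : R)
  (r : nat -> R) (delta c0 : R) :
  circle_mpt T1 ->
  exp_mixing_BV_Linf T1 ->
  0 < eps -> 0 < c ->
  (exists Q : nat, forall (q : nat) (p : int), (Q <= q)%N ->
     c * (ln (q%:R : R)) ^+ 2 * (ln (ln (q%:R : R))) `^ (1 + eps) / (q%:R) ^+ 2
       <= `| q%:R * alpha - p%:~R |) ->
  (forall n, 0 < r n) ->
  (forall m n : nat, (m <= n)%N -> r n <= r m) ->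
  0 < delta -> delta < eps -> 0 < c0 ->
  (exists N : nat, forall n : nat, (N <= n)%N ->
     c0 * (ln (n%:R : R)) ^+ 2 * (ln (ln (n%:R : R))) `^ (1 + delta) / (n%:R) ^+ 2
       <= r n) ->
  ((@lebesgue_measure R \x @lebesgue_measure R)
     (set_liminf (fun n => E_set T1 (rotation alpha) n (r n)) `&` (@I01 R `*` @I01 R))
   = 1)%E.
Proof.
move=> mptT [C [theta [C0 [theta0 mixing]]]] eps0 cpos dioph _ rdec delta0 _ c00 rbig.
have [a1 a10 sep] :=
  diophantine_separation alpha c (1 + eps) cpos (addr_gt0 ltr01 eps0) dioph.
have [b b0 [k0 rk]] := dyadic_radius_le c0 (1 + delta) r c00 (addr_gt0 ltr01 delta0) rbig.
(* The three terms ensure, in order, separation by 2 rho, rho k <= r (2^(k+1)), and rho <= 1/2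
   together with w <= 1. *)
pose a := Num.min (Num.min (a1 / 2) b) 2^-1.
have a0 : 0 < a by rewrite !lt_min divr_gt0 // b0 invr_gt0 ltr0n.
have a2 : a <= 2^-1 by rewrite ge_min lexx orbT.
have ab : a <= b by rewrite !ge_min lexx orbT.
have aa1 : 2 * a <= a1.
  have : a <= a1 / 2 by rewrite !ge_min lexx.
  lra.
(* [K theta >= 7] gives [expR (- theta * (K * k)) <= 8^-k], which beats the factor
   [n ^ 2 = 4^k]. *)
pose K := (Num.bound (7 / theta)).+1.
have K8 : 8 <= expR (theta * K%:R).
  have : 7 <= theta * K%:R.
    rewrite mulrC -ler_pdivrMr //.
    apply: le_trans (ltW (archi_boundP _)) _; first by rewrite divr_ge0 // ltW.
    by rewrite ler_nat.
  by have := expR_ge1Dx (theta * K%:R); lra.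
have [A [x [A0 x01 geo]]] :=
  geometric_avoidance_bound a C theta K (introT andP (conj a0 a2)) C0 isT K8.
pose rho k := a * dyadic_weight k.
pose I2 := @I01 R `*` @I01 R.
have mI2 : measurable I2 := measurable_I2.
pose Lam : {measure set _ -> \bar R} := (@lebesgue_measure R \x @lebesgue_measure R)%E.
pose F k := I2 `\` (E_set T1 (rotation alpha) (2 ^ k) (rho k) `&` I2).
have mF k : measurable (F k) by apply: measurableD => //; exact: measurable_E_set.
have F_le k : (0 < k)%N -> (Lam (F k) <= (A * x ^+ k)%:E)%E.
  move=> kpos; have v0 := dyadic_weight_gt0 (R := R) k kpos.
  have v1 := dyadic_weight_le1 (R := R) k kpos.
  apply: product_measure_le => //.
  - by rewrite mulr_ge0 ?exprn_ge0 // ltW //; case/andP: x01.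
  - exact: subDsetl.
  move=> y y01.
  have := geo k _ _ kpos erefl erefl; rewrite -lee_fin; apply: le_trans.
  apply: (@missed_rotation_orbit_measure R T1 alpha (rho k) y C theta _ (K * k)) => //.
  - by rewrite mulr_gt0 //=; apply: le_trans a2; rewrite ler_piMr // ltW.
  - move=> q p qk; apply: le_trans (sep k q p kpos qk).
    by rewrite mulrA ler_wpM2r // ltW.
  - by rewrite muln_gt0.
  - exact: leq_trunc_div.
  - exact: measurable_ysection.
  - by move=> z; rewrite /ysection /= => /set_mem [[]].
  - by move=> z; rewrite /ysection /= => /set_mem [zI nE] zE; apply: nE.
(* The shift makes every index positive and puts it beyond the threshold [k0] for the radii. *)
pose G k := F (k + k0.+1)%N.
have G0 : Lam (lim_sup_set G) = 0%E.
  apply: lim_sup_set_cvg0; first by move=> k; exact: mF.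
  apply: (geometric_series_lty _ A x (ltW A0) x01) => k.
  rewrite measure_ge0 /=; apply: le_trans (F_le _ _) _; first by rewrite addnS.
  have /andP[/ltW x0 /ltW x1] := x01.
  rewrite lee_fin; apply: ler_wpM2l; first exact: ltW.
  by rewrite exprD ler_piMr ?exprn_ge0 ?exprn_ile1.
pose L := set_liminf (fun n => E_set T1 (rotation alpha) n (r n)) `&` I2.
have LE : L = \bigcup_N \bigcap_(n in [set n | (N <= n)%N])
    (E_set T1 (rotation alpha) n (r n) `&` I2).
  apply/seteqP; split => [z [[N _ zN] zI]|z [N _ zN]].
    by exists N => // n Nn; split=> //; exact: zN.
  split; first by exists N => // n Nn; case: (zN n Nn).
  by case: (zN N (leqnn N)).
have mL : measurable L.
  rewrite LE; apply: bigcup_measurable => N _; apply: bigcap_measurable.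
    by exists N => /=.
  by move=> n _; exact: measurable_E_set.
(* A point lying in no G k from some index on is in every later dyadic encounter set. For 2^k <= n <
   2^(k+1) that set is inside the one for n, since rho k <= r (2^(k+1)) <= r n. *)
have LF : I2 `\` L `<=` lim_sup_set G.
  move=> z [zI nL] N _; apply: contrapT => nG; apply: nL; split=> //.
  exists (2 ^ (N + k0.+1))%N => // n /= Nn.
  have n0 : (0 < n)%N by rewrite (leq_trans _ Nn) // expn_gt0.
  pose k := trunc_log 2 n.
  have Nk : (N + k0.+1 <= k)%N by exact: trunc_log_max.
  have k0k : (k0.+1 <= k)%N := leq_trans (leq_addl _ _) Nk.
  have /andP[kn nk] : (2 ^ k <= n < 2 ^ k.+1)%N by exact: trunc_log_bounds.
  apply: (@E_setS R T1 (rotation alpha) (2 ^ k) n (rho k)) => //.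
    apply: le_trans (rdec n (2 ^ k.+1)%N (ltnW nk)).
    apply: le_trans (rk k (ltnW k0k)).
    by rewrite ler_wpM2r // ltW // dyadic_weight_gt0 // (leq_trans _ k0k).
  apply: contrapT => nE; apply: nG; exists (k - k0.+1)%N.
    by rewrite /= leq_subRL // addnC.
  by rewrite /G subnK //; split=> // -[].
have D0 : Lam (I2 `\` L) = 0%E.
  apply/eqP; rewrite eq_le measure_ge0 andbT -G0 le_measure ?inE //.
    exact: measurableD.
  by apply: bigcap_measurable => // N _; apply: bigcup_measurable => k _; exact: mF.
have LI : L `<=` I2 by move=> z [].
have E1 : Lam I2 = 1%E := product_lebesgue_I2.
change (Lam L = 1%E).
rewrite -E1 -(setDUK LI) measureU //; last 2 first.
- exact: measurableD.
- by rewrite setDIK.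
by rewrite [X in (_ + X)%E]D0 adde0.
Qed.
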